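(* Let $X$ be a regular strong Choquet space, $\Gamma$ a group of homeomorphisms of $X$, and $Y\subseteq X$ a $\Gamma$-invariant set. Let $\mathcal{U}$ be the family of open sets $U\subseteq X$ for which there is no finite set $\Delta\subseteq\Gamma$ such that $Y\subseteq\Delta\cdot U$. Let $\langle R_n\mid n\in\mathbb{N}\rangle$ be an increasing sequence of reflexive symmetric closed subsets of $X\times X$. Suppose there is a compact $\mathcal{I}_{\mathcal{U}}$-positive set $K\subseteq X$ such that: (a) for all $n\in\mathbb{N}$ and all $x\in K$ there is $\gamma\in\Gamma$ such that $(x,\gamma\cdot x)\notin R_n^{(4)}$; (b) for all $\gamma\in\Gamma$ there is $n\in\mathbb{N}$ such that for all $x\in\Gamma\cdot K$, $(x,\gamma\cdot x)\in R_n$. Then there is a map $\phi:2^\omega\to\mathcal{P}(X)$ such that for all $y,z\in2^\omega$: - $\phi(y)$ is a nonempty closed $G_\delta$ subset of $X$; - if $z\mathrel{\mathbb{E}_0}y$ then there is $\gamma\in\Gamma$ such that $\gamma\cdot\phi(z)=\phi(y)$; - if $\neg(z\mathrel{\mathbb{E}_0}y)$ then $\phi(y)\times\phi(z)\subseteq{\sim}\bigcup_{n\in\mathbb{N}}R_n$. In particular, there is a map $\phi':2^\omega\to X$ which is a homomorphism from $(\mathbb{E}_0,{\sim}\mathbb{E}_0)$ to $(E_\Gamma^X,{\sim}\bigcup_{n\in\mathbb{N}}R_n)$; that is, for all $c,d\in2^\omega$, $c\mathrel{\mathbb{E}_0}d$ implies $\phi'(c)\mathrel{E_\Gamma^X}\phi'(d)$,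 and $\neg(c\mathrel{\mathbb{E}_0}d)$ implies $(\phi'(c),\phi'(d))\notin\bigcup_{n}R_n$. Moreover, if $X$ is compact, then the homomorphism $\phi'$ can be chosen to take values in $\overline{\Gamma\cdot x}$ for some $x\in K$.
   Context: The strong Choquet game on a topological space $X$: in round $n<\omega$, player A chooses an open set $U_n\subseteq V_{n-1}$ (where $V_{-1}=X$) and a point $x_n\in U_n$, and player B responds with an open set $V_n\subseteq U_n$ containing $x_n$. Player B wins if $\bigcap_{n<\omega}V_n\neq\emptyset$. $X$ is strong Choquet if player B has a winning strategy. For a family $\mathcal{U}$ of open subsets of a topological space $X$, $\mathcal{I}_{\mathcal{U}}$ is the family of sets $F\subseteq X$ such that for every $U\in\mathcal{U}$ there is an open $V\supseteq F$ with $V\cup U\in\mathcal{U}$. A set $F\subseteq X$ is $\mathcal{I}_{\mathcal{U}}$-positive if $F\notin\mathcal{I}_{\mathcal{U}}$. $\Delta\cdot U=\bigcup_{\delta\in\Delta}\delta\cdot U$ (similarly $\Gamma\cdot K$, $\Gamma\cdot x$). $\overline{Z}$ is closure, ${\sim}Z$ is complement, $\mathcal{P}(X)$ is the power set. $R^{(k)}$ is the $k$-fold composition of the relation $R$ with itself. $\mathbb{E}_0$ is the equivalence relation of eventual equality on $2^\omega$. $E_\Gamma^X$ is the orbit equivalence relation of $\Gamma$ on $X$. *)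

(* Defs.v *)
From mathcomp Require Import all_boot.
From mathcomp Require Import all_classical topology borel_hierarchy.

Set Implicit Arguments.
Unset Strict Implicit.
Unset Printing Implicit Defensive.

Local Open Scope classical_set_scope.

Section StrongChoquet.
Context {X : topologicalType}.

(* A play of A is the sequence a of its moves a n = (U_n, x_n).  A strategy s
   of B maps each nonempty finite sequence of moves of A to a set; against
   the play a, the n-th answer of B is V_n = s [:: a 0; ...; a n]. *)
Definition answer (s : seq (set X * X) -> set X) (a : nat -> set X * X)
    (n : nat) : set X :=
  s (mkseq a n.+1).

(* The set V_{n-1} in which the n-th move of A has to be played. *)
Definition arena (s : seq (set X * X) -> set X) (a : nat -> set X * X)
    (n : nat) : set X :=
  if n is m.+1 then answer s a m else setT.

Definition legal_A (s : seq (set X * X) -> set X) (a : nat -> set X * X)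
    (n : nat) : Prop :=
  [/\ open (a n).1, (a n).1 `<=` arena s a n & (a n).1 (a n).2].

Definition legal_B (s : seq (set X * X) -> set X) (a : nat -> set X * X)
    (n : nat) : Prop :=
  [/\ open (answer s a n), answer s a n `<=` (a n).1 & answer s a n (a n).2].

(* The legality of the answers of B is required after every finite legal
   position: an illegal answer such as set0 could leave A without a legal move,
   so that no infinite legal play would ever witness it. *)
Definition winning_B (s : seq (set X * X) -> set X) : Prop :=
  (forall a n, (forall i, (i <= n)%N -> legal_A s a i) -> legal_B s a n) /\
  (forall a, (forall n, legal_A s a n) -> \bigcap_n answer s a n !=set0).

End StrongChoquet.

Definition strong_Choquet (X : topologicalType) : Prop :=
  exists s : seq (set X * X) -> set X, winning_B s.

Section HomeomorphismGroups.
Context {X : topologicalType}.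

Definition homeomorphism (f : X -> X) : Prop :=
  continuous f /\
  exists g : X -> X, [/\ cancel f g, cancel g f & continuous g].

Record homeo_group (G : set (X -> X)) : Prop := HomeoGroup {
  homeo_groupP : forall f, G f -> homeomorphism f;
  homeo_group1 : G idfun;
  homeo_groupM : forall f g, G f -> G g -> G (f \o g);
  homeo_groupV : forall f g, G f -> cancel f g -> cancel g f -> G g
}.

Definition translate (D : set (X -> X)) (A : set X) : set X :=
  \bigcup_(d in D) (d @` A).

Definition orbit_of (G : set (X -> X)) (x : X) : set X :=
  [set g x | g in G].

Definition orbit_rel (G : set (X -> X)) (x y : X) : Prop :=
  orbit_of G x y.

Definition invariant_under (G : set (X -> X)) (Y : set X) : Prop :=
  forall g, G g -> g @` Y = Y.

Definition non_covering (G : set (X -> X)) (Y : set X) : set (set X) :=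
  [set U | open U /\
     ~ exists D : set (X -> X),
         [/\ finite_set D, D `<=` G & Y `<=` translate D U]].

End HomeomorphismGroups.

Definition ideal_of {X : topologicalType} (UU : set (set X)) : set (set X) :=
  [set F | forall U, UU U ->
     exists V, [/\ open V, F `<=` V & UU (V `|` U)]].

Definition ideal_positive {X : topologicalType} (UU : set (set X))
    (F : set X) : Prop :=
  ~ ideal_of UU F.

(* comp_pow R k is R composed with itself, k factors in all, so that
   comp_pow R 1 = R and comp_pow R 0 is the diagonal. *)
Definition comp_pow {T : Type} (R : set (T * T)) (k : nat) : set (T * T) :=
  iter k (fun S : set (T * T) => (S \; R)%relation) diagonal.

Definition E0 (y z : nat -> bool) : Prop :=
  exists n, forall m, (n <= m)%N -> y m = z m.

(* Main.v *)
(* Among the sets that stay non-covering together with a witness U of the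
   positivity of K, take a maximal ideal M of open sets.  Compactness yields x in
   K with no neighbourhood in M, and such an x is uniformly recurrent: for every
   neighbourhood V of x, finitely many translates of the closure of V contain the
   orbit of x.  With (a), (b) and regularity, V then contains some g x that is
   not within three R_n-steps of x, however large n is.  This allows a Cantor scheme
   around the single point x: elements g_n of G and shrinking neighbourhoods A_n
   of x such that the blocks g_0^(y 0) ... g_n^(y n) A_n decrease along every
   branch y and are R_n-separated for branches that differ at n, while the blocks
   along each branch are moves of A against the winning strategy of B.  The set
   phi(y) is the intersection of the blocks along y. *)

Require Import Defs.
From mathcomp Require Import all_boot.
From mathcomp Require Import all_classical topology borel_hierarchy.

Set Implicit Arguments.
Unset Strict Implicit.
Unset Printing Implicit Defensive.

Local Open Scope classical_set_scope.

(** * Neighbourhood filters *)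

Lemma near_finite (T : Type) (F : set_system T) (I : choiceType) (D : set I)
    (P : I -> T -> Prop) : Filter F -> finite_set D ->
  (forall d, D d -> \forall t \near F, P d t) ->
  \forall t \near F, forall d, D d -> P d t.
Proof.
by move=> FF /finite_fsetP[E ->] PF; exact: (@filter_bigI T I E P F FF PF).
Qed.

Lemma near_closedC (X : topologicalType) (f : X -> X) (C : set X) x :
  continuous f -> closed C -> ~ C (f x) -> \forall z \near x, ~ C (f z).
Proof.
move=> cf cC nC; apply: (cf x (~` C)); apply: open_nbhs_nbhs; split=> //.
exact: closed_openC.
Qed.

(** * Ideals of open sets and uniform recurrence *)

Section Recurrence.
Context {X : topologicalType} (G : set (X -> X)).
Hypothesis G_group : homeo_group G.

Lemma group_inverse f : G f ->
  exists2 g, G g & [/\ cancel f g, cancel g f, continuous f & continuous g].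
Proof.
move=> Gf; have [fc [g [fg gf gc]]] := homeo_groupP G_group Gf.
by exists g => //; exact: (homeo_groupV G_group Gf fg gf).
Qed.

Lemma group_image f A : G f -> exists2 g, G g & f @` A = g @^-1` A.
Proof.
move=> Gf; have [g Gg [fg gf _ _]] := group_inverse Gf.
exists g => //; apply/seteqP; split=> [_ [a Aa <-]|a Aga] /=; first by rewrite fg.
by exists (g a).
Qed.

Lemma group_continuous f : G f -> continuous f.
Proof. by case/(homeo_groupP G_group). Qed.

Lemma open_image f A : G f -> open A -> open (f @` A).
Proof.
move=> Gf; have [g Gg ->] := group_image A Gf.
by apply: open_comp => x _; exact: group_continuous.
Qed.

Lemma closed_image f A : G f -> closed A -> closed (f @` A).
Proof.
move=> Gf; have [g Gg ->] := group_image A Gf.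
by apply: preimage_closed => x _; exact: group_continuous.
Qed.

(** Zorn's lemma is applied to the families closed under binary unions whose members stay
    non-covering after union with [U]. If the last clause failed for [V], adjoining [V] would
    enlarge a maximal family. *)
Lemma maximal_ideal (Y U : set X) : non_covering G Y U ->
  exists M : set (set X),
    [/\ forall A, M A -> open A /\ non_covering G Y (A `|` U),
        forall A B, M A -> M B -> M (A `|` B),
        M set0
      & forall V, open V -> ~ M V ->
          exists2 A, M A & ~ non_covering G Y (V `|` A)].
Proof.
move=> ncU.
pose NC := non_covering G Y.
have NCS A B : open A -> A `<=` B -> NC B -> NC A.
  move=> oA AB [_ nB]; split=> // -[D [Df DG YD]]; apply: nB.
  exists D; split=> // y /YD[d Dd [a Aa <-]].
  by exists d => //; exists a => //; exact: AB.
pose P (M : set (set X)) :=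
  (forall A, M A -> open A /\ NC (A `|` U)) /\
  (forall A B, M A -> M B -> M (A `|` B)).
have [F FP Ftot|M [[M1 M2] Mmax]] := @Zorn_bigcup _ P.
  split=> [A [M FM MA]|A B [M FM MA] [N FN NB]].
    by have [+ _] := FP _ FM; exact.
  have [MN|NM] := Ftot _ _ FM FN.
    by exists N => //; have [_] := FP _ FN; apply => //; exact: MN.
  by exists M => //; have [_] := FP _ FM; apply => //; exact: NM.
have oU : open U by case: ncU.
have oM A : M A -> open A by case/M1.
have ext V : open V -> NC (V `|` U) ->
    (forall A, M A -> NC (V `|` (A `|` U))) -> M V.
  move=> oV ncV ncVM.
  (* The ideal of open sets generated by [M], [V] and [U]. Zorn's lemma does not exclude an empty
     [M]; the first alternative serves that case. *)
  pose N := [set A : set X | open A /\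
    (A `<=` V `|` U \/ exists2 B, M B & A `<=` V `|` (B `|` U))].
  have MN : M `<=` N.
    move=> A MA; split; first exact: oM.
    by right; exists A => // a Aa; right; left.
  have PN : P N.
    split=> [A [oA AV]|A B [oA AV] [oB BV]].
      split=> //; case: AV => [AV|[B MB AV]].
        by apply: (NCS _ (V `|` U)) => //; [exact: openU|move=> a [/AV//|]; right].
      apply: (NCS _ (V `|` (B `|` U))); [exact: openU| |exact: ncVM].
      by move=> a [/AV//|]; right; right.
    split; first exact: openU.
    case: AV => [AV|[C MC AV]]; case: BV => [BV|[D MD BV]].
    - by left=> a [/AV|/BV].
    - right; exists D => // a [/AV[|]|/BV//]; [by left|by right; right].
    - right; exists C => // a [/AV//|/BV[|]]; [by left|by right; right].
    - right; exists (C `|` D); first exact: M2.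
      move=> a [/AV[|[|]]|/BV[|[|]]].
      + by left.
      + by right; left; left.
      + by right; right.
      + by left.
      + by right; left; right.
      + by right; right.
  have NM : M = N.
    by apply: contrapT => /eqP MnN; apply: (Mmax N) => //; rewrite properEneq.
  by rewrite NM; split=> //; left=> a; left.
have M0 : M set0.
  apply: ext; [exact: open0|by rewrite set0U|move=> A MA].
  by rewrite set0U; case: (M1 _ MA).
(* With [U] in [M], the union with [U] is absorbed into [A] in the maximality clause. *)
have MU : M U.
  apply: ext => //; first by rewrite setUid.
  by move=> A MA; rewrite setUCA setUid; case: (M1 _ MA).
exists M; split => // V oV nMV; apply: contrapT => nex; apply: nMV.
have ncA A : M A -> NC (V `|` A) by move=> MA; apply: contrapT => nc; apply: nex; exists A.
by apply: ext => // [|A MA]; [exact: ncA|apply/ncA/M2].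
Qed.

(** The sets [K] minus [A], for [A] in the maximal ideal, generate a proper filter: [K] contained in
    such an [A] would contradict positivity at [U]. A cluster point in [K] then has no open
    neighbourhood in the ideal. *)
Lemma positive_point (Y K : set X) : compact K ->
    ideal_positive (non_covering G Y) K ->
  exists M : set (set X),
    [/\ forall A, M A -> non_covering G Y A,
        forall A B, M A -> M B -> M (A `|` B)
      & exists2 x, K x & forall V, open V -> V x ->
          exists2 A, M A & ~ non_covering G Y (V `|` A)].
Proof.
move=> cK /existsNP[U /not_implyP[ncU nK]].
have [M [M1 M2 M0 M3]] := maximal_ideal ncU.
exists M; split=> //.
  move=> A /M1[oA [_ nA]]; split=> // -[D [Df DG YD]]; apply: nA.
  exists D; split=> // y /YD[d Dd [a Aa <-]].
  by exists d => //; exists a => //; left.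
pose F : set_system X := filter_from M (fun A => K `\` A).
have FF : ProperFilter F.
  apply: filter_from_proper.
    apply: filter_from_filter; first by exists set0.
    move=> A B MA MB; exists (A `|` B); first exact: M2.
    by move=> a [Ka nAB]; split; split=> // ?; apply: nAB; [left|right].
  move=> A MA; apply: contrapT => KA0; apply: nK; exists A.
  have [oA ncA] := M1 _ MA; split=> // a Ka; apply: contrapT => nAa.
  by apply: KA0; exists a.
have FK : F K by exists set0 => // a [].
have [x [Kx Fx]] := cK F FF FK.
exists x => // V oV Vx; apply: M3 => // MV.
have FV : F (K `\` V) by exists V.
have [y [[_ nV] Vy]] := Fx _ _ FV (open_nbhs_nbhs (conj oV Vx)).
exact: nV.
Qed.

(* Translates of V and of a set A of the ideal cover Y.  If g x stayed away from
   the translates of V, then Y would be covered near x by translates of A. *)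
Lemma uniformly_recurrent_point (Y K : set X) : invariant_under G Y ->
    compact K -> ideal_positive (non_covering G Y) K ->
  exists2 x, K x & forall V, open V -> V x ->
    exists D, [/\ finite_set D, D `<=` G &
      forall g, G g -> exists2 d, D d & (d @` closure V) (g x)].
Proof.
move=> Yinv cK /(positive_point cK)[M [M1 M2 [x Kx xM]]].
have YG g y : G g -> Y y -> Y (g y) by move=> Gg Yy; rewrite -(Yinv _ Gg); exists y.
exists x => // V oV Vx.
have [A MA ncVA] := xM V oV Vx.
have oVA : open (V `|` A) by apply: openU => //; case: (M1 _ MA).
have [D [Df DG YD]] : exists D, [/\ finite_set D, D `<=` G & Y `<=` translate D (V `|` A)].
  by apply: contrapT => nD; apply: ncVA.
exists D; split=> // g Gg; apply: contrapT => ngx.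
have Wx : \forall z \near x, forall d, D d -> ~ (d @` closure V) (g z).
  apply: near_finite => // d Dd; apply: near_closedC; first exact: group_continuous.
    by apply: closed_image; [exact: DG|exact: closed_closure].
  by move=> dgx; apply: ngx; exists d.
have [B MB ncWB] := xM _ (open_interior _) Wx.
have oB : open B by case: (M1 _ MB).
have [E [Ef EG YE]] : exists E, [/\ finite_set E, E `<=` G &
    Y `<=` translate E ([set z | forall d, D d -> ~ (d @` closure V) (g z)]° `|` B)].
  apply: contrapT => nE; apply: ncWB; split=> //; apply: openU => //.
  exact: open_interior.
have [h Gh [gh hg _ _]] := group_inverse Gg.
have [_] := M1 _ (M2 _ _ MA MB); apply.
(* If [y = e w] with [w] in the neighbourhood of [x], then [g w] is in [Y], hence of the form [d v]
   with [v] in [V] or [A]. The choice of the neighbourhood excludes [V], so [e \o (h \o d)] maps a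
   point of [A] to [y]. *)
exists (E `|` [set e \o (h \o d) | e in E & d in D]); split.
- by rewrite finite_setU; split=> //; exact: finite_image2.
- move=> f [/EG//|[e Ee [d Dd <-]]].
  apply: (homeo_groupM G_group); first exact: EG.
  by apply: (homeo_groupM G_group) => //; exact: DG.
- move=> y Yy; have [e Ee [w [/interior_subset Ww|Bw] ewy]] := YE _ Yy; last first.
    by exists e; [left|exists w => //; right].
  have Yw : Y w.
    have [e' Ge' [ee' _ _ _]] := group_inverse (EG _ Ee).
    by rewrite -(ee' w) ewy; exact: YG.
  have [d Dd [v [Vv|Av] dv]] := YD _ (YG _ _ Gg Yw).
    by case: (Ww d Dd); exists v => //; exact: subset_closure.
  exists (e \o (h \o d)); first by right; exists e => //; exists d.
  by exists v; [left|rewrite /= dv gh].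
Qed.

End Recurrence.

(** * Returns of the recurrent point at a large distance *)

Lemma comp_pow4 (T : Type) (R : set (T * T)) a b c d e :
  R (a, b) -> R (b, c) -> R (c, d) -> R (d, e) -> comp_pow R 4 (a, e).
Proof.
move=> ab bc cd de; rewrite /comp_pow /=.
by exists b => //; exists c => //; exists d => //; exists e.
Qed.

Lemma regular_shrink (X : topologicalType) (x : X) (V : set X) :
  regular_space X -> nbhs x V ->
  exists A, [/\ open A, A x & closure A `<=` V].
Proof.
move=> Xreg /Xreg[B Bx BV]; exists B°; split; first exact: open_interior.
  exact: nbhs_singleton (nbhs_interior Bx).
by apply: subset_trans BV; apply: closureS; exact: interior_subset.
Qed.

(** By (a) some [g x] is not four [R N]-steps from [x], and recurrence brings it back into [V] by
    the inverse of some [d] in [D]. Since [D] depends on [V] only, (b) provides one [N] for which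
    applying any [d] is a single [R N]-step on the orbit; three steps from [x] to the returned point
    would thus give four to [g x]. *)
Lemma far_return (X : topologicalType) (G : set (X -> X)) (Y K : set X)
    (R : nat -> set (X * X)) :
  regular_space X -> homeo_group G -> invariant_under G Y ->
  (forall m n, (m <= n)%N -> R m `<=` R n) ->
  compact K -> ideal_positive (non_covering G Y) K ->
  (forall n x, K x -> exists2 g, G g & ~ comp_pow (R n) 4 (x, g x)) ->
  (forall g, G g -> exists n, forall x, translate G K x -> R n (x, g x)) ->
  exists2 x, K x & forall V n, open V -> V x -> exists g, [/\ G g, V (g x) &
    forall y z, R n (x, y) -> R n (y, z) -> ~ R n (z, g x)].
Proof.
move=> Xreg Ggrp Yinv Rincr cK Kpos hyp_a hyp_b.
have [x Kx xrec] := uniformly_recurrent_point Ggrp Yinv cK Kpos.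
exists x => // V n oV Vx.
have [A [oA Ax AV]] := regular_shrink Xreg (open_nbhs_nbhs (conj oV Vx)).
have [D [Df DG Drec]] := xrec A oA Ax.
have RD : \forall N \near \oo, forall d, D d ->
    forall z, translate G K z -> R N (z, d z).
  apply: near_finite => // d /DG/hyp_b[m Rm].
  by exists m => // k /= mk z /Rm; exact: Rincr.
have [N [nN RN]] := filter_ex (filterI (nbhs_infty_ge n) RD).
have [g Gg ng] := hyp_a N x Kx.
have [d Dd [v /AV Vv dv]] := Drec g Gg.
have [d' Gd' [dd' _ _ _]] := group_inverse Ggrp (DG _ Dd).
have vE : v = d' (g x) by rewrite -dv dd'.
exists (d' \o g); split; [exact: (homeo_groupM Ggrp)|by rewrite /= -vE|].
move=> y z xy yz; rewrite /= -vE => zv; apply: ng.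
apply: comp_pow4 (Rincr _ _ nN _ xy) (Rincr _ _ nN _ yz) (Rincr _ _ nN _ zv) _.
rewrite -dv; apply: RN => //; exists (d' \o g); first exact: (homeo_groupM Ggrp).
by exists x.
Qed.

(** * Finite plays against the winning strategy *)

Section LegalPlays.
Context {X : topologicalType} (S : seq (set X * X) -> set X).
Hypothesis S_winning : winning_B S.

(** The empty play is treated apart because a winning strategy is unconstrained there. *)
Definition position (m : seq (set X * X)) : set X :=
  if m is [::] then setT else S m.

(** [v0] pads the finite play to an infinite one; legality of a move depends only on the moves up to
    it, so the padding is harmless. *)
Definition legal_play (v0 : set X * X) (m : seq (set X * X)) : Prop :=
  forall i, (i < size m)%N -> legal_A S (nth v0 m) i.

Lemma legal_A_eq a b n : (forall i, (i <= n)%N -> a i = b i) ->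
  legal_A S a n -> legal_A S b n.
Proof.
move=> ab; rewrite /legal_A -ab //; suff -> : arena S a n = arena S b n by [].
case: n ab => //= n ab; rewrite /answer; congr S.
by apply/eq_in_map => i; rewrite mem_iota add0n /= ltnS => /leqW/ab.
Qed.

Lemma legal_rcons v0 m v : legal_play v0 m -> open v.1 -> v.1 v.2 ->
  v.1 `<=` position m -> legal_play v0 (rcons m v).
Proof.
move=> lm ov vv vm i; rewrite size_rcons ltnS leq_eqVlt => /predU1P[->|im]; last first.
  apply: legal_A_eq (lm i im) => j ji.
  by rewrite nth_rcons (leq_ltn_trans ji im).
rewrite /legal_A nth_rcons ltnn eqxx; split=> //.
suff -> : arena S (nth v0 (rcons m v)) (size m) = position m by [].
case: m {lm vm} => //= w m; rewrite /answer; congr S.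
rewrite -[RHS](mkseq_nth v0); apply/eq_in_map => k.
rewrite mem_iota add0n => /= km.
by rewrite -rcons_cons nth_rcons /= km.
Qed.

Lemma legal_answer v0 m v : legal_play v0 (rcons m v) ->
  open (S (rcons m v)) /\ S (rcons m v) v.2.
Proof.
move=> lm; have [i im|] := S_winning.1 (nth v0 (rcons m v)) (size m).
  by apply: lm; rewrite size_rcons ltnS.
by rewrite /answer -(size_rcons m v) mkseq_nth nth_rcons ltnn eqxx.
Qed.

End LegalPlays.

(** * The Cantor scheme *)

Fixpoint past (T : Type) (e : nat -> T) (n : nat) : seq T :=
  if n is m.+1 then e m :: past e m else [::].

Lemma size_past (T : Type) (e : nat -> T) n : size (past e n) = n.
Proof. by elim: n => //= n ->. Qed.

(* One step of the construction: the group element, the neighbourhood of x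
   played (after translation) by A, and the part of it kept after the answers of B. *)
Record stage (X : Type) := Stage {
  shift : X -> X;
  trial : set X;
  kept : set X
}.

Section Branches.
Context {X : topologicalType} (x : X).
Implicit Types (d : seq (stage X)) (s : seq bool).

(* Stages and bits are listed in reverse chronological order. *)
Fixpoint branch d s : X -> X :=
  match d, s with
  | p :: d', b :: s' => branch d' s' \o (if b then shift p else idfun)
  | _, _ => idfun
  end.

(** Moves are appended at the end: [S] reads plays chronologically, whereas [d] and [s] are
    reversed. *)
Fixpoint branch_play d s : seq (set X * X) :=
  match d, s with
  | p :: d', b :: s' =>
      rcons (branch_play d' s') (branch d s @` trial p, branch d s x)
  | _, _ => [::]
  end.

Definition room d : set X := if d is p :: _ then kept p else setT.

Variables (G : set (X -> X)) (R : nat -> set (X * X))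
  (S : seq (set X * X) -> set X).

(** The conditions on a stage before B answers, hence without [kept]. Closures are put into the room
    so that the limit sets become closed; [trial_far] separates the two values of the new bit
    whatever the earlier bits are. *)
Record admissible d (p : stage X) : Prop := Admissible {
  shiftG : G (shift p);
  trial_open : open (trial p);
  trial_x : trial p x;
  trial_room : closure (trial p) `<=` room d;
  shift_room : shift p @` closure (trial p) `<=` room d;
  trial_far : forall s t, size s = size d -> size t = size d ->
    forall a b, trial p a -> trial p b ->
      ~ R (size d) (branch d s a, branch d t (shift p b))
}.

(** One set [kept p] around [x] serves all branches at once, although B answers each of them
    separately. *)
Record extends d (p : stage X) : Prop := Extends {
  extends_admissible :> admissible d p;
  kept_open : open (kept p);
  kept_x : kept p x;
  kept_trial : kept p `<=` trial p;
  kept_answer : forall s, size s = size (p :: d) ->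
    branch (p :: d) s @` kept p `<=` S (branch_play (p :: d) s)
}.

Fixpoint coherent d : Prop :=
  if d is p :: d' then coherent d' /\ extends d' p else True.

Hypothesis G_group : homeo_group G.

Lemma room_open d : coherent d -> open (room d).
Proof. by case: d => [_|p d [_ /kept_open]] //; exact: openT. Qed.

Lemma room_x d : coherent d -> room d x.
Proof. by case: d => [|p d [_ /kept_x]]. Qed.

Lemma bit_group (b : bool) g : G g -> G (if b then g else idfun).
Proof. by case: b => // _; exact: homeo_group1 G_group. Qed.

Lemma branchG d s : coherent d -> G (branch d s).
Proof.
elim: d s => [|p d IH] [|b s] //=; try by move=> *; exact: homeo_group1 G_group.
move=> [/IH Gd /shiftG Gp]; apply: (homeo_groupM G_group) => //.
exact: bit_group.
Qed.

Lemma branchG_cons d p s : coherent d -> G (shift p) -> G (branch (p :: d) s).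
Proof.
case: s => [_ _|b s cd Gp] /=; first exact: homeo_group1 G_group.
by apply: (homeo_groupM G_group); [exact: branchG|exact: bit_group].
Qed.

Lemma branch_closure_trial d p (b : bool) s : admissible d p ->
  branch (p :: d) (b :: s) @` closure (trial p) `<=` branch d s @` room d.
Proof.
move=> dp _ [a Ha <-]; exists ((if b then shift p else idfun) a) => //.
case: b => /=; last exact: trial_room dp _ Ha.
by apply: (shift_room dp); exists a.
Qed.

Lemma branch_trial d p (b : bool) s : admissible d p ->
  branch (p :: d) (b :: s) @` trial p `<=` branch d s @` room d.
Proof.
move=> dp; apply: subset_trans (branch_closure_trial dp).
by apply: image_subset; exact: subset_closure.
Qed.

Lemma branch_position d s : coherent d -> size s = size d ->
  branch d s @` room d `<=` position S (branch_play d s).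
Proof.
case: d s => [|p d] [|b s] // [_ dp] sd.
suff <- : S (branch_play (p :: d) (b :: s)) =
    position S (branch_play (p :: d) (b :: s)) by exact: (kept_answer dp sd).
by rewrite /=; case: (branch_play d s).
Qed.

Lemma legal_branch_cons v0 d p (b : bool) s : coherent d -> admissible d p ->
  size s = size d -> legal_play S v0 (branch_play d s) ->
  legal_play S v0 (branch_play (p :: d) (b :: s)).
Proof.
move=> cd dp sd lds; apply: legal_rcons => //=.
- apply: (open_image G_group); last exact: trial_open dp.
  exact: branchG_cons (b :: s) cd (shiftG dp).
- by exists x => //; exact: trial_x dp.
- exact: subset_trans (branch_trial dp) (branch_position cd sd).
Qed.

Lemma legal_branch v0 d s : coherent d -> size s = size d ->
  legal_play S v0 (branch_play d s).
Proof.
elim: d s => [|p d IH] [|b s] // [cd dp] [sd].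
by apply: legal_branch_cons (extends_admissible dp) _ _ => //; exact: IH.
Qed.

End Branches.

(** * Existence of the stages *)

Lemma near_pairC (T U : topologicalType) (h k : T -> U) (C : set (U * U)) x y :
  continuous h -> continuous k -> closed C -> ~ C (h x, k y) ->
  \forall zw \near (x, y), ~ C (h zw.1, k zw.2).
Proof.
move=> hc kc cC nC.
have : nbhs (h x, k y) (~` C).
  by apply: open_nbhs_nbhs; split=> //; exact: closed_openC.
case=> -[P Q] /= [Ph Qk] PQ.
exists (h @^-1` P, k @^-1` Q); first by split; [exact: hc|exact: kc].
by move=> [z w] [/= Pz Qw]; exact: (PQ (h z, k w)).
Qed.

Section Construction.
Context {X : topologicalType} (x : X) (G : set (X -> X))
  (R : nat -> set (X * X)) (S : seq (set X * X) -> set X).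
Hypotheses (X_regular : regular_space X) (G_group : homeo_group G)
  (S_winning : winning_B S).
Hypothesis R_incr : forall m n, (m <= n)%N -> R m `<=` R n.
Hypothesis R_sym : forall n x y, R n (x, y) -> R n (y, x).
Hypothesis R_closed : forall n, closed (R n).
Hypothesis R_orbit : forall g, G g ->
  exists n, forall h, G h -> R n (h x, g (h x)).
Hypothesis far : forall V n, open V -> V x -> exists g, [/\ G g, V (g x) &
  forall y z, R n (x, y) -> R n (y, z) -> ~ R n (z, g x)].

Lemma admissible_exists d : coherent x G R S d -> exists p, admissible x G R d p.
Proof.
move=> cd; pose n := size d.
have Gd s : G (branch d s) := branchG G_group s cd.
(* There are finitely many branches of length [n], so one [N] makes each of them a single [R N]-step
   on the orbit of [x]. *)
have RN : \forall N \near \oo, forall (s : n.-tuple bool) h, G h ->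
    R N (h x, branch d s (h x)).
  apply: filter_forall => s; have [m Rm] := R_orbit (Gd s).
  by exists m => // k /= mk h /Rm; exact: R_incr.
have [N [nN {}RN]] := filter_ex (filterI (nbhs_infty_ge n) RN).
have [g [Gg Vg gfar]] := far N (room_open cd) (room_x cd).
have sep : \forall zw \near (x, x), forall s t : n.-tuple bool,
    ~ R n (branch d s zw.1, branch d t (g zw.2)).
  apply: (filter_forall (nbhs_filter (x, x))) => s.
  apply: (filter_forall (nbhs_filter (x, x))) => t.
  apply: (near_pairC (k := branch d t \o g)) => //.
  - exact: (group_continuous G_group).
  - apply: (group_continuous G_group); exact: homeo_groupM.
  (* Otherwise [x], [branch d s x], [branch d t (g x)], [g x] would be three [R N]-steps, against
     the choice of [g]. *)
  move=> /(R_incr nN) Rst; apply: (gfar _ _ _ Rst).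
    exact: RN (homeo_group1 G_group).
  exact/R_sym/RN.
case: sep => -[P Q] /= [Px Qx] PQ.
have gV : nbhs x (g @^-1` room d).
  apply: (group_continuous G_group Gg); apply: open_nbhs_nbhs.
  by split=> //; exact: room_open cd.
have Vx : nbhs x (room d).
  by apply: open_nbhs_nbhs; split; [exact: room_open cd|exact: room_x cd].
have [A [oA Ax AV]] := regular_shrink X_regular
  (filterI (filterI Px Qx) (filterI Vx gV)).
(* The second [A] is a placeholder for [kept]. *)
exists (Stage g A A); split=> //=.
- by move=> a /AV[_ []].
- by move=> _ [a /AV[_ []] + + <-].
move=> s t /eqP ss /eqP st a b /subset_closure/AV[[Pa _] _].
move=> /subset_closure/AV[[_ Qb] _].
exact: (PQ (a, b) _ (Tuple ss) (Tuple st)).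
Qed.

Lemma extends_exists d : coherent x G R S d -> exists p, extends x G R S d p.
Proof.
move=> cd; have [[g A B] dp] := admissible_exists cd.
pose n := size d.
have Anbhs : nbhs x A.
  by apply: open_nbhs_nbhs; split; [exact: trial_open dp|exact: trial_x dp].
have kept_nbhs : \forall z \near x, A z /\ forall s : n.+1.-tuple bool,
    S (branch_play x (Stage g A B :: d) s) (branch (Stage g A B :: d) s z).
  apply: filterI => //; apply: filter_forall => -[[|b s] //= /eqP[ss]].
  have lds := legal_branch G_group (setT, x) cd ss.
  have [oS Sx] := legal_answer S_winning (legal_branch_cons (b := b) G_group cd dp ss lds).
  apply: (group_continuous G_group (branchG_cons G_group (b :: s) cd (shiftG dp))).
  by apply: open_nbhs_nbhs.
(* Replacing [B] is harmless: [branch] and [branch_play] depend only on shifts and trials. *)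
exists (Stage g A (interior [set z | A z /\ forall s : n.+1.-tuple bool,
    S (branch_play x (Stage g A B :: d) s) (branch (Stage g A B :: d) s z)])).
split=> /=.
- by case: dp.
- exact: open_interior.
- exact: nbhs_singleton (nbhs_interior kept_nbhs).
- by move=> z /interior_subset[].
move=> [|b s] //= ss _ [z /interior_subset[_ Sz] <-].
by move/eqP: ss => ss; exact: (Sz (@Tuple _ _ (b :: s) ss)).
Qed.

Lemma coherent_sequence : exists e : nat -> stage X,
  forall n, extends x G R S (past e n) (e n).
Proof.
pose P d p := coherent x G R S d -> extends x G R S d p.
have [F FP] : {F & forall d, P d (F d)}.
  apply: choice => d; have [cd|ncd] := pselect (coherent x G R S d).
    by have [p dp] := extends_exists cd; exists p.
  (* A default for incoherent histories, which the recursion below never meets. *)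
  by exists (Stage idfun setT setT).
pose fix build n := if n is m.+1 then F (build m) :: build m else [::].
have pastE n : past (F \o build) n = build n by elim: n => //= n ->.
exists (F \o build) => n; rewrite pastE; apply: (FP).
by elim: n => //= n IH; split=> //; exact: FP.
Qed.

End Construction.

(** * The limit sets along branches *)

Section Limit.
Context {X : topologicalType} (x : X) (G : set (X -> X))
  (R : nat -> set (X * X)) (S : seq (set X * X) -> set X).
Hypotheses (G_group : homeo_group G) (S_winning : winning_B S).
Context (e : nat -> stage X).
Hypothesis e_extends : forall n, extends x G R S (past e n) (e n).
Implicit Types y z : nat -> bool.

Lemma coherent_past n : coherent x G R S (past e n).
Proof. by elim: n => //= n IH; split=> //; exact: e_extends. Qed.

Let path y n : X -> X := branch (past e n) (past y n).

Let block y n : set X := path y n.+1 @` trial (e n).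

Definition limit_set y : set X := \bigcap_n block y n.

Lemma pathG y n : G (path y n).
Proof. exact: (branchG G_group (past y n) (coherent_past n)). Qed.

Lemma closure_blockS y n :
  path y n.+2 @` closure (trial (e n.+1)) `<=` block y n.
Proof.
apply: subset_trans (branch_closure_trial (e_extends n.+1)) _.
by apply: image_subset; exact: kept_trial (e_extends n).
Qed.

Lemma block_decr y m n : (m <= n)%N -> block y n `<=` block y m.
Proof.
move=> /subnKC <-; elim: (n - m)%N => [|k IH]; first by rewrite addn0.
rewrite addnS; apply: subset_trans IH.
by apply: subset_trans (@closure_blockS _ _); apply: image_subset; exact: subset_closure.
Qed.

(** Each closed block lies in the preceding open block. The open form gives [Gdelta], the closed
    form closedness and the capture of cluster points. *)
Lemma limit_setE y :
  limit_set y = \bigcap_n (path y n.+1 @` closure (trial (e n))).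
Proof.
apply/seteqP; split=> p yp n _.
  by have [a Aa <-] := yp n I; exists a => //; exact: subset_closure.
by apply: closure_blockS; exact: yp.
Qed.

Lemma limit_set_closed y : closed (limit_set y).
Proof.
rewrite limit_setE; apply: closed_bigI => n _.
by apply: (closed_image G_group (pathG _ _)); exact: closed_closure.
Qed.

Lemma limit_set_Gdelta y : Gdelta (limit_set y).
Proof.
exists (block y) => // n; apply: (open_image G_group (pathG _ _)).
exact: trial_open (e_extends n).
Qed.

Lemma limit_set_neq0 y : limit_set y !=set0.
Proof.
pose a n := (block y n, path y n.+1 x).
have playE n : branch_play x (past e n) (past y n) = mkseq a n.
  by elim: n => //= n ->; rewrite mkseqS.
have la n : legal_A S a n.
  have := @legal_branch _ _ _ _ _ G_group (setT, x) _ (past y n.+1) (coherent_past n.+1).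
  rewrite !size_past playE => /(_ erefl n); rewrite size_mkseq => /(_ (leqnn _)).
  by apply: legal_A_eq => i ni; rewrite nth_mkseq.
(* The blocks along [y] are a legal run of A, and each answer of B lies inside the block it
   answers. *)
have [p Sp] := S_winning.2 a la; exists p => n _.
by have [_ + _] := S_winning.1 a n (fun i _ => la i); apply; exact: Sp.
Qed.

(** The images of [x] along the branch are orbit points that eventually lie in every block, so a
    cluster point of them lies in every closed block. *)
Lemma limit_set_cluster y : compact [set: X] ->
  (limit_set y `&` closure (orbit_of G x)) !=set0.
Proof.
move=> cX; pose u n := path y n.+1 x.
have [p [_ up]] := cX (u @ \oo) _ filterT.
exists p; split=> [|B pB]; last first.
  apply: up pB; exists 0%N => // n _ /=.
  by exists (path y n.+1) => //; exact: pathG.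
rewrite limit_setE => n _.
apply: (closed_image G_group (pathG y n.+1) (@closed_closure _ _)) => B pB.
apply: up pB; exists n => // m /= nm.
have [a Aa <-] : block y n (u m).
  by apply: block_decr nm _ _; exists x => //; exact: trial_x (e_extends m).
by exists a => //; exact: subset_closure.
Qed.

Lemma limit_set_far n y z : y n != z n ->
  (forall m p q, R m (p, q) -> R m (q, p)) ->
  limit_set y `*` limit_set z `<=` ~` R n.
Proof.
move=> yz Rsym [p q] [/= yp zq].
have [a Aa ap] := yp n I; have [b Ab bq] := zq n I.
have sz (w : nat -> bool) : size (past w n) = size (past e n) by rewrite !size_past.
(* [trial_far] treats only bit false against bit true; the opposite order follows by symmetry of
   [R n]. *)
have := trial_far (e_extends n) (sz y) (sz z) Aa Ab.
have := trial_far (e_extends n) (sz z) (sz y) Ab Aa.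
move: ap bq yz; rewrite /path /= size_past.
case: (y n); case: (z n) => //= <- <- _ nba nab //; by move/Rsym.
Qed.

Lemma path_shift y z : E0 z y ->
  exists2 g, G g & exists n, forall m, (n <= m)%N -> path y m = g \o path z m.
Proof.
case=> n zy; have [h Gh [zh hz _ _]] := group_inverse G_group (pathG z n).
(* Past [n] the bits agree, so both paths are extended on the right by the same factors and this
   quotient persists. *)
exists (path y n \o h); first exact: homeo_groupM (pathG y n) Gh.
exists n => m /subnKC <-; elim: (m - n)%N => [|k IH].
  by rewrite addn0; apply/funext => p /=; rewrite zh.
rewrite addnS; apply/funext => p.
rewrite /path /= -/(path y (n + k)) -/(path z (n + k)) IH.
by rewrite zy // leq_addr.
Qed.

Lemma limit_set_image y z g n :
  (forall m, (n <= m)%N -> path y m = g \o path z m) ->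
  g @` limit_set z `<=` limit_set y.
Proof.
move=> yz _ [p zp <-] m _; apply: (block_decr (leq_maxl m n)).
have [a Aa <-] := zp (maxn m n) I; exists a => //.
by rewrite yz // leqW // leq_maxr.
Qed.

Lemma limit_set_E0 y z : E0 z y ->
  exists2 g, G g & g @` limit_set z = limit_set y.
Proof.
move=> /path_shift[g Gg [n yz]]; exists g => //.
have [h Gh [gh hg _ _]] := group_inverse G_group Gg.
apply/seteqP; split; first exact: limit_set_image yz.
move=> p yp; exists (h p) => //.
suff /(_ (h p)) : h @` limit_set y `<=` limit_set z by apply; exists p.
apply: (@limit_set_image _ _ _ n) => m nm.
by rewrite yz //; apply/funext => q /=; rewrite gh.
Qed.

End Limit.

(** * Selecting points equivariantly over [E0]-classes *)

Lemma E0_refl y : E0 y y.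
Proof. by exists 0%N. Qed.

Lemma E0_sym y z : E0 y z -> E0 z y.
Proof. by move=> [n yz]; exists n => m /yz. Qed.

Lemma E0_trans y z w : E0 y z -> E0 z w -> E0 y w.
Proof.
move=> [m yz] [n zw]; exists (maxn m n) => k; rewrite geq_max => /andP[mk nk].
by rewrite yz // zw.
Qed.

Lemma not_E0_differ n y z : ~ E0 y z -> exists2 m, (n <= m)%N & y m != z m.
Proof.
move=> nyz; apply: contrapT => nex; apply: nyz; exists n => m nm.
by apply: contrapT => /eqP yz; apply: nex; exists m.
Qed.

(* One representative of each E0-class is fixed, a point is chosen in its fibre,
   and it is transported to the fibres over the rest of the class. *)
Lemma E0_equivariant_selection (X : topologicalType) (G : set (X -> X))
    (phi : (nat -> bool) -> set X) (C : set X) :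
  homeo_group G ->
  (forall y z, E0 z y -> exists2 g, G g & g @` phi z = phi y) ->
  (forall y, phi y `&` C !=set0) ->
  (forall g p, G g -> C p -> C (g p)) ->
  exists f : (nat -> bool) -> X,
    (forall c, phi c (f c) /\ C (f c)) /\
    (forall c d, E0 c d -> orbit_rel G (f c) (f d)).
Proof.
move=> Ggrp phiE phiC CG.
pose rep c := xget (fun=> false) [set d | E0 d c].
have repE c : E0 (rep c) c.
  rewrite /rep; case: xgetP => [d -> //|/(_ c)[]]; exact: E0_refl.
have rep_eq c d : E0 c d -> rep c = rep d.
  move=> cd; rewrite /rep; congr xget; apply/seteqP; split=> b /= bE.
    exact: E0_trans bE cd.
  exact: E0_trans bE (E0_sym cd).
have [p phip] := choice phiC.
have [h Gh] : {h & forall c, G (h c) /\ h c @` phi (rep c) = phi c}.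
  apply: (@choice _ _ (fun c g => G g /\ g @` phi (rep c) = phi c)) => c.
  by have [g Gg gE] := phiE _ _ (repE c); exists g.
exists (fun c => h c (p (rep c))); split=> [c|c d cd].
  have [Gc hE] := Gh c; have [phic Cc] := phip (rep c).
  by split; [rewrite -hE; exists (p (rep c))|exact: CG].
have [k Gk [hk _ _ _]] := group_inverse Ggrp (Gh c).1.
exists (h d \o k); first exact: homeo_groupM (Gh d).1 Gk.
by rewrite /= hk (rep_eq _ _ cd).
Qed.

Lemma closure_orbit_invariant (X : topologicalType) (G : set (X -> X)) x g p :
  homeo_group G -> G g -> closure (orbit_of G x) p ->
  closure (orbit_of G x) (g p).
Proof.
move=> Ggrp Gg xp B /(group_continuous Ggrp Gg)/xp[_ [[h Gh <-] Bh]].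
by exists (g (h x)); split=> //; exists (g \o h) => //; exact: homeo_groupM.
Qed.

Theorem theorem2p18 (X : topologicalType)
  (X_regular : @regular_space X)
  (X_Choquet : strong_Choquet X)
  (G : set (X -> X)) (G_group : homeo_group G)
  (Y : set X) (Y_inv : invariant_under G Y)
  (R : nat -> set (X * X))
  (R_incr : forall m n, (m <= n)%N -> R m `<=` R n)
  (R_refl : forall n x, R n (x, x))
  (R_sym : forall n x y, R n (x, y) -> R n (y, x))
  (R_closed : forall n, closed (R n))
  (K : set X) (K_compact : compact K)
  (K_pos : ideal_positive (non_covering G Y) K)
  (hyp_a : forall n x, K x ->
     exists2 g, G g & ~ comp_pow (R n) 4 (x, g x))
  (hyp_b : forall g, G g ->
     exists n, forall x, translate G K x -> R n (x, g x)) :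
  [/\ exists phi : (nat -> bool) -> set X,
        forall y z : nat -> bool,
          [/\ phi y !=set0 /\ closed (phi y) /\ Gdelta (phi y),
              E0 z y -> exists2 g, G g & g @` phi z = phi y
            & ~ E0 z y -> phi y `*` phi z `<=` ~` \bigcup_n R n],
      exists phi' : (nat -> bool) -> X,
        forall c d : nat -> bool,
          (E0 c d -> orbit_rel G (phi' c) (phi' d)) /\
          (~ E0 c d -> ~ (\bigcup_n R n) (phi' c, phi' d))
    & compact [set: X] ->
      exists phi' : (nat -> bool) -> X,
        (forall c d : nat -> bool,
          (E0 c d -> orbit_rel G (phi' c) (phi' d)) /\
          (~ E0 c d -> ~ (\bigcup_n R n) (phi' c, phi' d))) /\
        exists2 x, K x & forall c, closure (orbit_of G x) (phi' c)].
Proof.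
have [S S_winning] := X_Choquet.
have [x Kx far] :=
  far_return X_regular G_group Y_inv R_incr K_compact K_pos hyp_a hyp_b.
have R_orbit g : G g -> exists n, forall h, G h -> R n (h x, g (h x)).
  move=> /hyp_b[n Rn]; exists n => h Gh; apply: Rn.
  by exists h => //; exists x.
have [e e_extends] := coherent_sequence X_regular G_group S_winning R_incr
  R_sym R_closed R_orbit far.
pose phi := limit_set e.
have phiE0 y z : E0 z y -> exists2 g, G g & g @` phi z = phi y.
  exact: (limit_set_E0 G_group e_extends).
have phi_far y z : ~ E0 z y -> phi y `*` phi z `<=` ~` \bigcup_n R n.
  move=> nzy pq phipq [n _ Rpq].
  (* The sequences differ at some [m] beyond [n], and separation for [R m] implies separation for
     the smaller [R n]. *)
  have [m nm zym] := not_E0_differ n nzy.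
  rewrite eq_sym in zym.
  exact: (limit_set_far e_extends zym R_sym phipq (R_incr _ _ nm _ Rpq)).
(* Used with [C] the whole space, and for compact [X] with the orbit closure of [x]. *)
have select C : (forall y, phi y `&` C !=set0) ->
    (forall g p, G g -> C p -> C (g p)) ->
    exists phi' : (nat -> bool) -> X,
      (forall c d : nat -> bool,
        (E0 c d -> orbit_rel G (phi' c) (phi' d)) /\
        (~ E0 c d -> ~ (\bigcup_n R n) (phi' c, phi' d))) /\
      forall c, C (phi' c).
  move=> phiC CG.
  have [f [fphi forb]] := E0_equivariant_selection G_group phiE0 phiC CG.
  exists f; split=> [c d|c]; last by have [] := fphi c.
  split=> [|ncd]; first exact: forb.
  have [[fc _] [fd _]] := (fphi c, fphi d).
  by apply: (phi_far c d _ (f c, f d)) => // /E0_sym.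
split.
- exists phi => y z; split; [|exact: phiE0|exact: phi_far].
  split; first exact: (limit_set_neq0 G_group S_winning e_extends y).
  by split; [exact: (limit_set_closed G_group e_extends)
            |exact: (limit_set_Gdelta G_group e_extends y)].
- have [y|//|f [fE _]] := select setT; last by exists f.
  by rewrite setIT; exact: (limit_set_neq0 G_group S_winning e_extends y).
move=> cX; have [y|g p Gg|f [fE fx]] := select (closure (orbit_of G x)).
- exact: (limit_set_cluster G_group e_extends y cX).
- exact: closure_orbit_invariant.
by exists f; split=> //; exists x.
Qed.
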